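(* Let $q$ be an odd prime and let $\mathcal{C}$ be a proper array code (PAC) with modulus $q$ whose parity-check matrix $H$ has column weight $r$. If $r=4$, then the Tanner graph of $\mathcal{C}$ contains a cycle of length six if and only if there exist three distinct block-columns of $H$ whose labels $i,j,k$ satisfy at least one of the congruences $$-2i+j+k \equiv 0 \pmod q, \qquad -3i+j+2k \equiv 0 \pmod q.$$ If $r=3$, then the Tanner graph of $\mathcal{C}$ contains a cycle of length six if and only if there exist three distinct block-columns of $H$ whose labels $i,j,k$ satisfy $-2i+j+k \equiv 0 \pmod q$.
   Context: For integers $a\le b$, $[a,b]$ denotes $\{x\in\mathbb{Z}: a\le x\le b\}$. Let $q$ be an odd prime, let $I$ be the $q\times q$ identity matrix, and let $P$ be a $q\times q$ circulant permutation matrix with $P\neq I$. Given an integer $r\in[1,q]$ and distinct integers $a_0,\dots,a_{r-1}\in[0,q-1]$ (the block-row labels), the array code with modulus $q$ is the binary linear code whose parity-check matrix $H$ is the $rq\times q^2$ matrix made of an $r\times q$ array of $q\times q$ blocks, the block in block-row $i\in[0,r-1]$ and block-column $j\in[0,q-1]$ being $P^{a_i\cdot j}$. Its column weight is $r$. The integer $j$ is the label of the $j$-th block-column. The code is a proper array code (PAC) if $a_0,\dots,a_{r-1}$ form an arithmetic progression with nonzero common difference, i.e. there is an integer $a\neq 0$ with $a_{i+1}-a_i=a$ for all $i\in[0,r-2]$. The Tanner graph of a code with parity-check matrix $H$ is the bipartite graph with one vertex per column and one per row of $H$, a column vertex and a row vertex being adjacent iff the corresponding entry of $H$ is $1$.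 *)

(* Defs.v *)
From mathcomp Require Import all_boot all_order all_algebra.

Set Implicit Arguments.
Unset Strict Implicit.
Unset Printing Implicit Defensive.

Local Open Scope ring_scope.

(* [ordS] is the cyclic successor i |-> i + 1 mod n on 'I_n. *)
Definition circulant_mx (R : Type) (n : nat) (A : 'M[R]_n) : Prop :=
  forall i j : 'I_n, A (ordS i) (ordS j) = A i j.

(* The numbers of rows and columns, r * q and q * q, appear as the sums of the
   block heights and widths, as [\mxblock] requires. *)
Definition array_pcm (q r : nat) (P : 'M['F_2]_q) (a : 'I_r -> 'I_q) :
    'M['F_2]_(\sum_(i < r) q, \sum_(j < q) q) :=
  \mxblock_(i < r, j < q) (P ^+ (a i * j)).

(* The common difference is an integer, not a residue modulo q, and may be
   negative. *)
Definition proper_labels (q r : nat) (a : 'I_r -> 'I_q) : Prop :=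
  exists2 d : int, d != 0 &
    forall i i' : 'I_r, i' = i.+1 :> nat -> (a i')%:Z - (a i)%:Z = d.

Definition tanner_adj (m n : nat) (H : 'M['F_2]_(m, n)) : rel ('I_m + 'I_n) :=
  fun u v =>
    match u, v with
    | inl x, inr y | inr y, inl x => H x y == 1
    | _, _ => false
    end.

Definition has_cycle (T : finType) (e : rel T) (l : nat) : Prop :=
  exists c : seq T, [/\ (2 < l)%N, size c = l & ucycle e c].

(* Main.v *)
(* In coordinates mod [q], [P] is the shift by some [c != 0], so column [y] of
   block-column [j] meets row [x] of block-row [i] iff [y = x + c * a_i * j].
   Going once around a hexagon through block-rows [i1, i2, i3] and block-columns
   [j1, j2, j3], the shifts must cancel:
     (a_i1 - a_i2) * j1 + (a_i2 - a_i3) * j2 + (a_i3 - a_i1) * j3 = 0,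
   and both triples of labels are distinct; conversely any solution closes up.
   For a progression the common difference is invertible mod [q] and drops out;
   up to symmetry [i1 < i2 < i3], so the gaps [i2 - i1, i3 - i2] are [1, 1], and
   for [r = 4] also [1, 2] or [2, 1], which gives the listed congruences. *)
Require Import Defs.
From mathcomp Require Import all_boot all_order all_fingroup all_algebra.
From mathcomp Require Import ring.

Set Implicit Arguments.
Unset Strict Implicit.
Unset Printing Implicit Defensive.

Import GRing.Theory.
Local Open Scope ring_scope.

(** Bipartiteness makes the six vertices alternate between rows and columns. *)
Lemma tanner_hexagonP (m n : nat) (H : 'M['F_2]_(m, n)) :
  has_cycle (tanner_adj H) 6 <->
  exists x1 x2 x3 y1 y2 y3,
    [/\ uniq [:: x1; x2; x3], uniq [:: y1; y2; y3] &
        [&& H x1 y1 == 1, H x2 y1 == 1, H x2 y2 == 1, H x3 y2 == 1,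
            H x3 y3 == 1 & H x1 y3 == 1]].
Proof.
split=> [[c [_ szc /andP[adj_c uniq_c]]]|].
  (* A cycle that starts at a column starts at a row after rotation by one. *)
  wlog [x1 [c1 def_c]] : c szc adj_c uniq_c / exists x1 c1, c = inl x1 :: c1.
    case: c szc adj_c uniq_c => [//|[x|y] c] szc adj_c uniq_c wl.
      by apply: (wl (inl x :: c)) => //; exists x, c.
    apply: (wl (rot 1 (inr y :: c))); rewrite ?size_rot ?rot_cycle ?rot_uniq //.
    case: c szc adj_c {uniq_c wl} => [//|[x|//] c] _ _.
    by exists x, (c ++ [:: inr y]).
  move: szc adj_c uniq_c; rewrite {}def_c.
  (* Two consecutive vertices of the same kind are never adjacent, so only the alternating pattern
     survives. *)
  do 5![case: c1 => [|[?|?] c1] //=]; rewrite ?andbF //.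
  case: c1 => // _; rewrite /= andbT => adj_c; rewrite !inE /= !andbT !negb_or.
  move=> /and4P[/and3P[x12 x13 _] /andP[y12 y13] /andP[x23 _] y23].
  do 6!eexists; split; last exact: adj_c; rewrite !inE !negb_or !andbT -andbA.
    by apply/and3P.
  by apply/and3P.
move=> [x1 [x2 [x3 [y1 [y2 [y3 [ux uy /and5P[h1 h2 h3 h4 /andP[h5 h6]]]]]]]]].
exists [:: inl x1; inr y1; inl x2; inr y2; inl x3; inr y3]; split=> //.
apply/andP; split; first by rewrite /= h1 h2 h3 h4 h5 h6.
by move: ux uy; rewrite /= !inE !negb_or /= !andbT => /andP[-> ->] ->.
Qed.

(** The last entry comes first because [j3] will become the label [i] of the congruences. *)
Lemma uniq3P (T : eqType) (x y z : T) :
  reflect [/\ z != x, z != y & x != y] (uniq [:: x; y; z]).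
Proof.
rewrite /= !inE negb_or andbT -andbA !(eq_sym _ z).
by apply: (iffP and3P) => [[]|[]].
Qed.

Lemma perm_mxX (R : pzSemiRingType) n (s : 'S_n) k :
  perm_mx s ^+ k = perm_mx (s ^+ k)%g :> 'M[R]_n.
Proof.
elim: k => [|k IHk]; first by rewrite expr0 expg0 perm_mx1.
by rewrite exprS IHk expgS perm_mxM.
Qed.

Lemma tagnat_const_inj (n q : nat) (u v : 'I_(\sum_(i < n) q)) :
  tagnat.sig1 u = tagnat.sig1 v -> tagnat.sig2 u = tagnat.sig2 v :> nat ->
  u = v.
Proof.
by move=> e1 e2; apply: val_inj; rewrite /= tagnat.rect e1 e2 -tagnat.rect.
Qed.

Section PrimeField.
Variables (q : nat) (q_prime : prime q).

Lemma natr_Fp_inj : injective (fun i : 'I_q => i%:R : 'F_q).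
Proof.
move=> i j /(congr1 (@nat_of_ord _)) /=.
by rewrite !val_Fp_nat // !modn_small //; apply: val_inj.
Qed.

Lemma natr_Fp_surj (x : 'F_q) : exists i : 'I_q, i%:R = x.
Proof.
have lt_xq : (x < q)%N by rewrite -[q in (_ < q)%N]Fp_cast.
by exists (Ordinal lt_xq); rewrite /= natr_Zp.
Qed.

Lemma eqz_mod0_Fp (z : int) : (z = 0 %[mod q])%Z <-> z%:~R = 0 :> 'F_q.
Proof.
have eqE : (z == 0 %[mod q])%Z = (z%:~R == 0 :> 'F_q).
  by rewrite eqz_mod_dvd subr0 (dvdz_pcharf (pchar_Fp q_prime)).
by split=> /eqP h; apply/eqP; move: h; rewrite eqE.
Qed.

(** Commuting with the successor, [s] is determined by the image of 0, which is the shift [c]. *)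
Lemma perm_ordS_shift (s : {perm 'I_q}) :
  (forall i, s (ordS i) = ordS (s i)) ->
  exists c : 'F_q, forall i, (s i)%:R = i%:R + c.
Proof.
move=> s_ordS; pose i0 := Ordinal (prime_gt0 q_prime).
have ordSE (i : 'I_q) : (ordS i)%:R = i%:R + 1 :> 'F_q.
  by rewrite /= Fp_nat_mod // -natr1.
exists (s i0)%:R => -[k lt_kq] /=; elim: k lt_kq => [|k IHk] lt_kq.
  by rewrite add0r; congr (s _)%:R; apply: val_inj.
have -> : Ordinal lt_kq = ordS (Ordinal (ltnW lt_kq)).
  by apply: val_inj; rewrite /= modn_small.
by rewrite s_ordS ordSE IHk -natr1 addrAC.
Qed.

Lemma array_pcmP (P : 'M['F_2]_q) :
  is_perm_mx P -> circulant_mx P -> P != 1%:M ->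
  exists2 c : 'F_q, c != 0 &
    forall r (a : 'I_r -> 'I_q) u v,
      (array_pcm P a u v == 1) =
        ((tagnat.sig2 v)%:R == (tagnat.sig2 u)%:R
           + c * (a (tagnat.sig1 u))%:R * (tagnat.sig1 v)%:R :> 'F_q).
Proof.
move=> /is_perm_mxP[s ->] circ neq1.
have perm_entry (t : 'S_q) i j : (perm_mx t i j == 1 :> 'F_2) = (t i == j).
  by rewrite !mxE; case: (t i == j).
have s_ordS i : s (ordS i) = ordS (s i).
  by apply/eqP; rewrite -perm_entry circ perm_entry.
have [c sE] := perm_ordS_shift s_ordS.
exists c.
  apply: contra neq1 => /eqP c0.
  suff -> : s = 1%g by rewrite perm_mx1.
  by apply/permP=> i; apply: natr_Fp_inj; rewrite sE c0 addr0 perm1.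
move=> r a u v; rewrite mxE perm_mxX perm_entry.
have sXE k i : ((s ^+ k)%g i)%:R = i%:R + c *+ k.
  elim: k => [|k IHk]; first by rewrite expg0 perm1 addr0.
  by rewrite expgSr permM sE IHk mulrSr addrA.
by rewrite -(inj_eq natr_Fp_inj) sXE -[c *+ _]mulr_natr natrM mulrA eq_sym.
Qed.

Lemma array_hexagonP (P : 'M['F_2]_q) r (a : 'I_r -> 'I_q) :
  is_perm_mx P -> circulant_mx P -> P != 1%:M ->
  has_cycle (tanner_adj (array_pcm P a)) 6 <->
  exists (i1 i2 i3 : 'I_r) (j1 j2 j3 : 'I_q),
    [/\ uniq [:: i1; i2; i3], uniq [:: j1; j2; j3] &
        ((a i1)%:R - (a i2)%:R) * j1%:R + ((a i2)%:R - (a i3)%:R) * j2%:R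
          + ((a i3)%:R - (a i1)%:R) * j3%:R = 0 :> 'F_q].
Proof.
move=> P_perm P_circ P_neq1.
have [c c_neq0 adjE] := array_pcmP P_perm P_circ P_neq1.
rewrite tanner_hexagonP; split.
  (* Two rows of one block-row that meet a common column have equal offsets and coincide; likewise
     for columns. So distinct vertices of the hexagon lie in distinct blocks. *)
  have row_neq u u' v : array_pcm P a u v == 1 -> array_pcm P a u' v == 1 ->
      u != u' -> tagnat.sig1 u != tagnat.sig1 u'.
    rewrite !adjE => /eqP-> uv; apply: contra => /eqP e; apply/eqP.
    apply: (tagnat_const_inj e); move: uv; rewrite e => /eqP/addIr.
    by move/natr_Fp_inj ->.
  have col_neq u v v' : array_pcm P a u v == 1 -> array_pcm P a u v' == 1 ->
      v != v' -> tagnat.sig1 v != tagnat.sig1 v'.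
    rewrite !adjE => uv uv'; apply: contra => /eqP e; apply/eqP.
    apply: (tagnat_const_inj e); move: uv; rewrite e -(eqP uv') => /eqP.
    by move/natr_Fp_inj ->.
  move=> [u1 [u2 [u3 [v1 [v2 [v3 []]]]]]].
  rewrite /= !inE !negb_or !andbT -!andbA => /and3P[u12 u13 u23].
  move=> /and3P[v12 v13 v23] /and5P[h11 h21 h22 h32 /andP[h33 h13]].
  exists (tagnat.sig1 u1), (tagnat.sig1 u2), (tagnat.sig1 u3).
  exists (tagnat.sig1 v1), (tagnat.sig1 v2), (tagnat.sig1 v3).
  rewrite /= !inE !negb_or !andbT -!andbA; split.
  - by apply/and3P; split; [apply: (row_neq _ _ v1)|apply: (row_neq _ _ v3)
                           |apply: (row_neq _ _ v2)].
  - by apply/and3P; split; [apply: (col_neq u2)|apply: (col_neq u1)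
                           |apply: (col_neq u3)].
  apply: (mulfI c_neq0); rewrite mulr0.
  (* Eliminating the three column offsets leaves three equations whose sum no longer involves the
     row offsets. *)
  move: h11 h21 h22 h32 h33 h13; rewrite !adjE.
  move=> /eqP h11 /eqP + /eqP h22 /eqP + /eqP h33 /eqP.
  rewrite {}h11 {}h22 {}h33 => e1 e2 e3.
  have /eqP := congr2 +%R (congr2 +%R e1 e2) e3.
  by rewrite -subr_eq0 => /eqP <-; ring.
move=> [i1 [i2 [i3 [j1 [j2 [j3 [ui uj cycle0]]]]]]].
pose A i : 'F_q := c * (a i)%:R.
(* The first offset is free, and 0 is chosen. Each of the next five is forced by one edge; the sixth
   edge, back to [x1], is then exactly [cycle0] multiplied by [c]. *)
have [x1 x1E] := natr_Fp_surj 0.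
have [y1 y1E] := natr_Fp_surj (A i1 * j1%:R).
have [x2 x2E] := natr_Fp_surj (y1%:R - A i2 * j1%:R).
have [y2 y2E] := natr_Fp_surj (x2%:R + A i2 * j2%:R).
have [x3 x3E] := natr_Fp_surj (y2%:R - A i3 * j2%:R).
have [y3 y3E] := natr_Fp_surj (x3%:R + A i3 * j3%:R).
pose rank n (k : 'I_n) x := @tagnat.Rank n (fun=> q) k x.
have rankE n (k : 'I_n) x : tagnat.sig2 (rank n k x) = x :> nat.
  by rewrite tagnat.Rank2K.
have rank_neq n (k k' : 'I_n) x x' : k != k' -> rank n k x != rank n k' x'.
  by apply: contra => /eqP /(congr1 tagnat.sig1); rewrite !tagnat.Rank1K => ->.
exists (rank _ i1 x1).
exists (rank _ i2 x2).
exists (rank _ i3 x3).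
exists (rank _ j1 y1).
exists (rank _ j2 y2).
exists (rank _ j3 y3).
move: ui uj; rewrite /= !inE !negb_or !andbT -!andbA.
move=> /and3P[i12 i13 i23] /and3P[j12 j13 j23].
split; [by rewrite !rank_neq|by rewrite !rank_neq|].
rewrite !adjE !rankE !tagnat.Rank1K.
rewrite y3E x3E y2E x2E y1E x1E /A.
apply/and5P; split; last (apply/andP; split); apply/eqP; try ring.
by apply/subr0_eq; rewrite -[RHS](mulr0 c) -[in RHS]cycle0; ring.
Qed.

(** A nonzero integer difference could still vanish mod [q]. It does not, because the first two
    labels are distinct elements of [[0, q-1]]. *)
Lemma proper_labels_Fp r (a : 'I_r -> 'I_q) :
  (1 < r)%N -> injective a -> proper_labels a ->
  exists a0 d : 'F_q, d != 0 /\ forall i, (a i)%:R = a0 + d * i%:R.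
Proof.
move=> r_gt1 a_inj [d _ a_step].
pose i0 := Ordinal (ltnW r_gt1); pose i1 := Ordinal r_gt1.
have aE i : (a i)%:R = (a i0)%:R + d%:~R * i%:R :> 'F_q.
  case: i => k; elim: k => [|k IHk] lt_kr /=.
    by rewrite mulr0 addr0; congr (a _)%:R; apply: val_inj.
  have := a_step (Ordinal (ltnW lt_kr)) (Ordinal lt_kr) erefl.
  move=> /eqP; rewrite subr_eq => /eqP /(congr1 (intr : int -> 'F_q)).
  by rewrite rmorphD /= -!pmulrn IHk -natr1 => ->; ring.
exists (a i0)%:R, d%:~R; split=> //; apply/eqP=> d0.
suff : i1 = i0 by [].
by apply/a_inj/natr_Fp_inj; rewrite aE d0 mul0r addr0.
Qed.

(** Rotating the hexagon preserves the equation and reflecting it changes only the sign; these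
    symmetries realize every permutation of the three block-rows, so they can be sorted. *)
Lemma proper_array_hexagonP (P : 'M['F_2]_q) r (a : 'I_r -> 'I_q) :
  is_perm_mx P -> circulant_mx P -> P != 1%:M ->
  (1 < r)%N -> injective a -> proper_labels a ->
  has_cycle (tanner_adj (array_pcm P a)) 6 <->
  exists (i1 i2 i3 : 'I_r) (j1 j2 j3 : 'I_q),
    [/\ (i1 < i2 < i3)%N, uniq [:: j1; j2; j3] &
        (i1%:R - i2%:R) * j1%:R + (i2%:R - i3%:R) * j2%:R
          + (i3%:R - i1%:R) * j3%:R = 0 :> 'F_q].
Proof.
move=> P_perm P_circ P_neq1 r_gt1 a_inj a_proper.
have [a0 [d [d_neq0 aE]]] := proper_labels_Fp r_gt1 a_inj a_proper.
rewrite array_hexagonP //.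
split=> -[i1 [i2 [i3 [j1 [j2 [j3 []]]]]]]; last first.
  move=> /andP[lt12 lt23] uj sum0; exists i1, i2, i3, j1, j2, j3; split=> //.
    by rewrite /= !inE -!val_eqE /= !ltn_eqF // (ltn_trans lt12).
  by rewrite !aE -[RHS](mulr0 d) -[in RHS]sum0; ring.
move=> + uj sumA0; rewrite /= !inE negb_or andbT -andbA => /and3P[n12 n13 n23].
have {sumA0} : (i1%:R - i2%:R) * j1%:R + (i2%:R - i3%:R) * j2%:R
    + (i3%:R - i1%:R) * j3%:R = 0 :> 'F_q.
  by apply: (mulfI d_neq0); rewrite mulr0 -[RHS]sumA0 !aE; ring.
wlog lt12 : i1 i2 j2 j3 n12 n13 n23 uj / (i1 < i2)%N => [wl sum0|sum0].
  have [lt12|lt21|/val_inj e12] := ltngtP i1 i2; last by rewrite e12 eqxx in n12.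
    exact: (wl i1 i2 j2 j3).
  (* This is the reflection that fixes [j1]. *)
  apply: (wl i2 i1 j3 j2) => //; first by rewrite eq_sym.
    by rewrite -rev_uniq -(rot_uniq 2) in uj.
  by rewrite -[RHS]oppr0 -[in RHS]sum0; ring.
have [lt23|lt32|/val_inj e23] := ltngtP i2 i3; last by rewrite e23 eqxx in n23.
  by exists i1, i2, i3, j1, j2, j3; rewrite lt12 lt23.
have [lt13|lt31|/val_inj e13] := ltngtP i1 i3; last by rewrite e13 eqxx in n13.
  exists i1, i3, i2, j3, j2, j1; rewrite lt13 lt32; split=> //.
    by rewrite -rev_uniq in uj.
  by rewrite -[RHS]oppr0 -[in RHS]sum0; ring.
exists i3, i1, i2, j3, j1, j2; rewrite lt31 lt12; split=> //.
  by rewrite -(rot_uniq 2) in uj.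
by rewrite -[RHS]sum0; ring.
Qed.

End PrimeField.

Theorem theorem2 (q r : nat) (P : 'M['F_2]_q) (a : 'I_r -> 'I_q)
  (q_prime : prime q) (q_odd : odd q)
  (P_perm : is_perm_mx P) (P_circ : circulant_mx P) (P_neq1 : P != 1%:M)
  (r_range : (1 <= r <= q)%N) (a_inj : injective a)
  (a_proper : proper_labels a) :
  (r = 4%N ->
     (has_cycle (tanner_adj (array_pcm P a)) 6 <->
      exists i j k : 'I_q,
        [/\ i != j, i != k & j != k] /\
        ((- 2 * i%:Z + j%:Z + k%:Z = 0 %[mod q])%Z \/
         (- 3 * i%:Z + j%:Z + 2 * k%:Z = 0 %[mod q])%Z)))
  /\
  (r = 3%N ->
     (has_cycle (tanner_adj (array_pcm P a)) 6 <->
      exists i j k : 'I_q,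
        [/\ i != j, i != k & j != k] /\
        (- 2 * i%:Z + j%:Z + k%:Z = 0 %[mod q])%Z)).
Proof.
have cong2E (i j k : 'I_q) : (- 2 * i%:Z + j%:Z + k%:Z = 0 %[mod q])%Z <->
    - 2%:R * i%:R + j%:R + k%:R = 0 :> 'F_q.
  by rewrite eqz_mod0_Fp // !rmorphD rmorphM /=.
have cong3E (i j k : 'I_q) : (- 3 * i%:Z + j%:Z + 2 * k%:Z = 0 %[mod q])%Z <->
    - 3%:R * i%:R + j%:R + 2%:R * k%:R = 0 :> 'F_q.
  by rewrite eqz_mod0_Fp // !rmorphD !rmorphM /=.
split=> rE; rewrite (proper_array_hexagonP q_prime P_perm) //; try by rewrite rE.
- subst r; split.
    move=> [i1 [i2 [i3 [j1 [j2 [j3 [lt_i /uniq3P[n31 n32 n12] sum0]]]]]]].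
    (* The sorted triples are 012, 013, 023 and 123. The column [j3] has the outer gap [i3 - i1] as
       coefficient, equal to 2 or 3, hence it takes the role of [i]. *)
    case: i1 i2 i3 lt_i sum0 =>
      [[|[|[|[|//]]]] ?] [[|[|[|[|//]]]] ?] [[|[|[|[|//]]]] ?] //= _ sum0.
    + exists j3, j1, j2; split=> //; left; apply/cong2E.
      by rewrite -[RHS]oppr0 -[in RHS]sum0; ring.
    + exists j3, j1, j2; split=> //; right; apply/cong3E.
      by rewrite -[RHS]oppr0 -[in RHS]sum0; ring.
    (* The gaps are 2, 1 instead of 1, 2, so [j1] and [j2] trade places. *)
    + exists j3, j2, j1; split; first by rewrite eq_sym in n12.
      right; apply/cong3E; rewrite -[RHS]oppr0 -[in RHS]sum0; ring.
    + exists j3, j1, j2; split=> //; left; apply/cong2E.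
      by rewrite -[RHS]oppr0 -[in RHS]sum0; ring.
  move=> [i [j [k [/uniq3P uj cong]]]].
  case: cong => [/cong2E|/cong3E] e.
    (* Block-rows 0, 1, 2 realize the gaps 1, 1; for the other congruence 0, 1, 3 realize 1, 2. *)
    exists (@Ordinal 4 0 isT), (@Ordinal 4 1 isT), (@Ordinal 4 2 isT), j, k, i.
    by split=> //; rewrite -[RHS]oppr0 -[in RHS]e /=; ring.
  exists (@Ordinal 4 0 isT), (@Ordinal 4 1 isT), (@Ordinal 4 3 isT), j, k, i.
  by split=> //; rewrite -[RHS]oppr0 -[in RHS]e /=; ring.
subst r; split.
  move=> [i1 [i2 [i3 [j1 [j2 [j3 [lt_i /uniq3P[n31 n32 n12] sum0]]]]]]].
  case: i1 i2 i3 lt_i sum0 =>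
    [[|[|[|//]]] ?] [[|[|[|//]]] ?] [[|[|[|//]]] ?] //= _ sum0.
  exists j3, j1, j2; split=> //; apply/cong2E.
  by rewrite -[RHS]oppr0 -[in RHS]sum0; ring.
move=> [i [j [k [/uniq3P uj /cong2E e]]]].
exists (@Ordinal 3 0 isT), (@Ordinal 3 1 isT), (@Ordinal 3 2 isT), j, k, i.
by split=> //; rewrite -[RHS]oppr0 -[in RHS]e /=; ring.
Qed.
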